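(* Let $\mathbb F$ be a field, $n\ge2$, and suppose $\mathcal C$ is an $\{n,\frac{n(n+1)}{2}-4,4\}_{\mathbb F}$ code. Then there exists a cap of cardinality $n$ in $\mathrm{PG}(3,\mathbb F)$, i.e. a set of $n$ points no three of which are collinear. In particular, $n\le 8$ if $|\mathbb F|=2$, and $n\le|\mathbb F|^2+1$ if $\mathbb F$ is finite with $|\mathbb F|>2$.
   Context: $\mathrm{U}(n,\mathbb F)$ is the space of $n\times n$ upper triangular matrices over $\mathbb F$. For $M\in\mathrm{U}(n,\mathbb F)$, $M_{[i]}$ is the submatrix with rows $1,\dots,i$ and columns $i,\dots,n$, and $\mathrm{w}_{\mathrm{fr}}(M)=\sum_{i=1}^n\operatorname{rk}(M_{[i]})$. An $\{n,t,\delta\}_{\mathbb F}$ code is an $\mathbb F$-linear subspace of $\mathrm{U}(n,\mathbb F)$ of dimension $t$ whose minimum $\mathrm{w}_{\mathrm{fr}}$ over nonzero elements is $\delta$. $\mathrm{PG}(3,\mathbb F)$ is the projective space of $\mathbb F^4$. *)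

(* Defs.v *)
From HB Require Import structures.
From mathcomp Require Import all_boot all_order all_algebra.
From mathcomp Require Import finmap.

Set Implicit Arguments.
Unset Strict Implicit.
Unset Printing Implicit Defensive.

Local Open Scope ring_scope.

Definition upper_triangular (F : fieldType) (n : nat) (M : 'M[F]_n) : bool :=
  [forall i : 'I_n, forall j : 'I_n, (j < i)%N ==> (M i j == 0)].

(* The column with index i + b among the last n - i columns. *)
Definition flag_col (n : nat) (i : 'I_n) (b : 'I_(n - i)) : 'I_n :=
  cast_ord (subnKC (ltnW (ltn_ord i))) (rshift i b).

(* M_[i]. Indices start at 0: rows 0, ..., i and columns i, ..., n - 1. *)
Definition flag_submx (F : fieldType) (n : nat) (M : 'M[F]_n) (i : 'I_n) :
    'M[F]_(i.+1, n - i) :=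
  mxsub (widen_ord (ltn_ord i)) (@flag_col n i) M.

Definition flag_rank_weight (F : fieldType) (n : nat) (M : 'M[F]_n) : nat :=
  (\sum_(i < n) \rank (flag_submx M i))%N.

(* C is an {n, t, d}_F code. The minimum is required to be attained, so the
   zero subspace is never a code with these parameters. *)
Definition flag_rank_code (F : fieldType) (n t d : nat)
    (C : {vspace 'M[F]_n}) : Prop :=
  [/\ forall M, M \in C -> upper_triangular M,
      \dim C = t,
      exists M, [/\ M \in C, M != 0 & flag_rank_weight M = d]
    & forall M, M \in C -> M != 0 -> (d <= flag_rank_weight M)%N].

(* Points of PG(k, F): one-dimensional subspaces of F^(k+1). *)
Record pg_point (k : nat) (F : fieldType) : Type := PGPoint {
  pg_space : {vspace 'rV[F]_k.+1};
  _ : \dim pg_space == 1%N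
}.

HB.instance Definition _ (k : nat) (F : fieldType) :=
  [isSub for @pg_space k F].
HB.instance Definition _ (k : nat) (F : fieldType) :=
  [Choice of pg_point k F by <:].

Definition collinear (k : nat) (F : fieldType) (P Q R : pg_point k F) : Prop :=
  exists L : {vspace 'rV[F]_k.+1},
    [/\ \dim L = 2, (pg_space P <= L)%VS, (pg_space Q <= L)%VS
      & (pg_space R <= L)%VS].

Definition cap (k : nat) (F : fieldType) (S : {fset pg_point k F}) : Prop :=
  forall P Q R : pg_point k F, P \in S -> Q \in S -> R \in S ->
    P != Q -> P != R -> Q != R -> ~ collinear P Q R.

(* T is finite with exactly q elements. *)
Definition has_card (T : eqType) (q : nat) : Prop :=
  exists2 e : seq T, Finite.axiom e & size e = q.

(* Main.v *)
(* Let f be a linear map from the upper triangular matrices to F^4 with kernel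
   C, and put p_i = f(E_ii), e_i = f(E_{i,i+1}). A diagonal matrix with at most
   three nonzero entries has weight at most 3, so any three p_i are independent:
   they form a cap. A combination of E_ii, E_{i,i+1} and E_{i+1,i+1} has weight
   at most 2, so the plane W_i spanned by p_i, e_i, p_{i+1} contains no further
   p_k.

   When F has q elements this yields n <= 3 + (q - 1) q, for all q and without
   the classical theorems on caps. Project from p_1: the p_k with k > 2 have
   distinct images in PG(2, F), and these avoid the two distinct lines that are
   the images of W_0 and W_1. The complement of two lines has q^2 - q points. *)

Require Import Defs.
From HB Require Import structures.
From mathcomp Require Import all_boot all_order all_algebra.
From mathcomp Require Import finmap.
From mathcomp Require Import zify.

Set Implicit Arguments.
Unset Strict Implicit.
Unset Printing Implicit Defensive.

Import GRing.Theory.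

Local Open Scope ring_scope.

(** * Cutting out subspaces by linear equations *)

Lemma linear_equations (F : fieldType) (vT : vectType F) (k : nat)
    (U C : {vspace vT}) :
  (C <= U)%VS -> (\dim U <= \dim C + k)%N ->
  exists f : 'Hom(vT, 'rV[F]_k), forall v, v \in U -> f v = 0 -> v \in C.
Proof.
(* [W] is a complement of [C] in [U]; the equations will be coordinates of the [W]-component. *)
move=> CU dimU; pose W := (U :\: C)%VS.
have WC : (W :&: C)%VS = 0%VS by rewrite /W capv_diff.
have dimW : (\dim W <= k)%N.
  by have := dimv_cap_compl U C; rewrite (capv_idPr CU) -/W; lia.
(* Zeros pad the basis to length exactly [k]. The family may fail to be free, but its [coord] still
   recovers every vector of its span. *)
pose s := vbasis W ++ nseq (k - \dim W) 0.
have sk : size s == k by rewrite size_cat size_tuple size_nseq subnKC.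
pose X := Tuple sk.
have spanX v : v \in W -> v \in <<X>>%VS.
  rewrite -{1}(span_basis (vbasisP W)); apply/subvP/span_subvP => w wW.
  by rewrite memv_span //= mem_cat wW.
pose g v := \row_(i < k) coord X i (daddv_pi W C v).
have lin_g : linear g.
  by move=> a u v; apply/rowP => i; rewrite !mxE !linearP.
pose gl := GRing.isLinear.Build F vT 'rV[F]_k *:%R g lin_g.
pose gL : {linear vT -> 'rV[F]_k} := HB.pack g gl.
exists (linfun gL) => v vU; rewrite lfunE /= => gv0.
have vWC : v \in (W + C)%VS.
  suff /subvP : (U <= W + C)%VS by apply.
  by rewrite -(addv_diff_cap U C) addvS // capvSr.
rewrite -[v](@daddv_pi_add _ _ W C _ WC vWC).
have -> : daddv_pi W C v = 0.
  rewrite (coord_span (spanX _ (memv_pi W C v))) big1 // => i _.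
  by move/rowP: gv0 => /(_ i); rewrite !mxE => ->; rewrite scale0r.
by rewrite add0r memv_pi.
Qed.

(** The cokernel matrix of [A] has rank one, hence is a column times a nonzero row; that column is
    the equation. *)
Lemma hyperplane_equation (F : fieldType) (k : nat) (A : 'M[F]_(k, k.+1)) :
  row_free A -> exists h : 'cV[F]_k.+1, forall v : 'rV_k.+1,
    v *m h = 0 <-> (v <= A)%MS.
Proof.
move=> freeA.
have rk1 : \rank (cokermx A) = 1%N.
  by rewrite mxrank_coker (eqP freeA) subSn // subnn.
move: (col_base (cokermx A)) (row_base (cokermx A))
  (mulmx_base (cokermx A)) (row_base_free (cokermx A)).
rewrite rk1 => h r hr freer; exists h => v; rewrite submxE -hr mulmxA.
split=> [-> | /eqP]; first by rewrite mul0mx eqxx.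
by rewrite -(mul0mx _ r) => /(row_free_inj freer).
Qed.

Lemma plane_equation (F : fieldType) (a b c : 'rV[F]_4) :
  (forall x y z, x *: a + y *: b + z *: c = 0 -> [/\ x = 0, y = 0 & z = 0]) ->
  exists h : 'cV[F]_4, forall v, (v *m h) 0 0 = 0 <->
    exists x y z, v = x *: a + y *: b + z *: c.
Proof.
move=> indep; pose A := \matrix_(i < 3) [:: a; b; c]`_i.
have rowA (v : 'rV[F]_3) : v *m A = v 0 0 *: a + v 0 1 *: b + v 0 2 *: c.
  rewrite mulmx_sum_row !big_ord_recl big_ord0 addr0 !rowK /= addrA.
  by congr (v _ _ *: _ + v _ _ *: _ + v _ _ *: _); apply: val_inj.
have [|h hP] := @hyperplane_equation F 3 A.
  apply: inj_row_free => v; rewrite rowA => /indep [x0 y0 z0].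
  apply/rowP => i; rewrite mxE.
  by case: i => [[|[|[|//]]] lti];
    [rewrite -[RHS]x0 | rewrite -[RHS]y0 | rewrite -[RHS]z0];
    congr (v _ _); apply: val_inj.
exists h => v; have -> : (v *m h) 0 0 = 0 <-> (v <= A)%MS.
  rewrite -hP; split=> [vh0 | ->]; last by rewrite mxE.
  by apply/matrixP => i j; rewrite !ord1 vh0 mxE.
split=> [/submxP[x ->] | [x [y [z ->]]]].
  by exists (x 0 0), (x 0 1), (x 0 2).
apply/submxP; exists (\row_i [:: x; y; z]`_i).
by rewrite rowA !mxE.
Qed.

(** * Dimension of the upper triangular matrices *)

Lemma sum_ord_succ n : (\sum_(i < n) i.+1 = (n * n.+1) %/ 2)%N.
Proof.
rewrite divn2; elim: n => [|n IH]; first by rewrite big_ord0.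
by rewrite big_ord_recr /= IH; lia.
Qed.

Lemma upper_triangular_vspace (F : fieldType) n :
  exists2 U : {vspace 'M[F]_n},
    (forall M, upper_triangular M -> M \in U) &
    (\dim U <= (n * n.+1) %/ 2)%N.
Proof.
(* Pairs are (column, row), so that column [j] carries [j.+1] matrix units, as in [sum_ord_succ]. *)
pose P (p : 'I_n * 'I_n) := (p.2 <= p.1)%N.
exists <<[seq delta_mx p.2 p.1 | p in P]>>%VS => [M /forallP upM|].
  rewrite (matrix_sum_delta M) memv_suml // => i _.
  rewrite memv_suml // => j _.
  have [ji | ij] := ltnP j i.
    by have /forallP/(_ j) := upM i; rewrite ji => /eqP ->;
       rewrite scale0r mem0v.
  by rewrite memvZ // memv_span //; apply/imageP; exists (j, i).
apply: leq_trans (dim_span _) _; rewrite size_image -sum1_card.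
have -> : (\sum_(p in P) 1 = \sum_(j < n) \sum_(i < n | (i <= j)%N) 1)%N.
  by rewrite pair_big_dep.
rewrite -sum_ord_succ leq_eqVlt; apply/orP; left; apply/eqP.
apply: eq_bigr => j _.
rewrite -(big_ord_widen_cond _ predT (fun=> 1%N) (ltn_ord j)) /=.
by rewrite sum1_card card_ord.
Qed.

(** * Flag-rank weights of sparse matrices *)

Section FlagRank.
Variables (F : fieldType) (n : nat).
Implicit Types (M : 'M[F]_n) (i j k : 'I_n).

Lemma flag_submx_rank0 M i :
  (forall r c : 'I_n, (r <= i)%N -> (i <= c)%N -> M r c = 0) ->
  \rank (flag_submx M i) = 0%N.
Proof.
move=> M0; apply/eqP; rewrite mxrank_eq0; apply/eqP/matrixP => r c.
rewrite !mxE M0 //=; first by rewrite -ltnS.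
exact: leq_addr.
Qed.

Lemma flag_submx_rank1_row M i :
  (forall r c : 'I_n, (r < i)%N -> (i <= c)%N -> M r c = 0) ->
  (\rank (flag_submx M i) <= 1)%N.
Proof.
move=> M0.
have -> : flag_submx M i = delta_mx ord_max 0 *m row ord_max (flag_submx M i).
  apply/matrixP => r c; rewrite !mxE big_ord1 !mxE andbT.
  have [-> | nr] := eqVneq r ord_max; rewrite ?mul1r ?mul0r // M0 //=.
    by move: nr (ltn_ord r); rewrite -val_eqE /=; lia.
  exact: leq_addr.
exact: leq_trans (mxrankM_maxl _ _) (rank_leq_col _).
Qed.

Lemma flag_submx_rank1_col M i :
  (forall r c : 'I_n, (r <= i)%N -> (i < c)%N -> M r c = 0) ->
  (\rank (flag_submx M i) <= 1)%N.
Proof.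
move=> M0; have i0 : (0 < n - i)%N by rewrite subn_gt0.
have -> : flag_submx M i =
    col (Ordinal i0) (flag_submx M i) *m delta_mx 0 (Ordinal i0).
  apply/matrixP => r c; rewrite !mxE big_ord1 !mxE /=.
  have [-> | nc] := eqVneq c (Ordinal i0); rewrite ?mulr1 ?mulr0 // M0 //=.
    by rewrite -ltnS.
  by move: nc; rewrite -val_eqE /=; lia.
exact: leq_trans (mxrankM_maxl _ _) (rank_leq_col _).
Qed.

(* The only off-diagonal entry sits at (i, i'), next to the diagonal: in the
   flag submatrices at i and i' it shares a row, respectively a column, with
   the only possible diagonal entry, so all flag submatrices have rank <= 1. *)
Lemma flag_rank_weight_le M i i' (s : seq 'I_n) :
  i' = i.+1 :> nat ->
  (forall r c, r != c -> (r, c) != (i, i') -> M r c = 0) ->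
  (forall k, k \notin s -> M k k = 0) ->
  (M i i' != 0 -> (i \in s) && (i' \in s)) ->
  (flag_rank_weight M <= size s)%N.
Proof.
move=> ii' supp diag0 off; apply: leq_trans (card_size s).
(* The rank at each [k] is compared with the indicator of [s] at [k]. *)
rewrite -sum1_card big_mkcond; apply: leq_sum => k _.
case: ifP => ks.
  (* At [k = i'] the off-diagonal entry lies in the first column of the submatrix; for any other [k]
     it can only lie in the last row. *)
  have [ki | ki] := eqVneq k i'.
    apply: flag_submx_rank1_col => r c rk kc.
    apply: supp; first by apply: contraTneq kc => <-; lia.
    by apply: contraTneq kc => -[_ ->]; rewrite ki ltnn.
  apply: flag_submx_rank1_row => r c rk kc.
  apply: supp; first by apply: contraTneq kc => <-; lia.
  apply: contraNneq ki => -[ri ci]; apply/eqP/val_inj => /=.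
  by move: rk kc; rewrite ri ci ii'; lia.
(* Only the submatrices at [i] and [i'] contain the off-diagonal entry, and if it is nonzero both
   indices are in [s]. *)
rewrite flag_submx_rank0 // => r c rk kc.
have [rc | rc] := eqVneq r c.
  have rk' : r = k by apply: val_inj => /=; move: rk kc; rewrite -rc; lia.
  by rewrite -rc rk' diag0 // ks.
have [[ri ci]|ric] := eqVneq (r, c) (i, i'); last exact: supp.
rewrite ri ci; apply: contraFeq ks => /off/andP[si si'].
have [<- //|ki] := eqVneq i k.
suff <- : i' = k by [].
apply: val_inj => /=; move: rk kc ki; rewrite ri ci -val_eqE /= ii'.
lia.
Qed.

End FlagRank.

(** * The parity-check map and independence of syndromes *)

Lemma code_parity_check (F : fieldType) (n t : nat) (C : {vspace 'M[F]_n}) :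
  (t + 4 = (n * n.+1) %/ 2)%N -> flag_rank_code t 4 C ->
  exists f : 'Hom('M[F]_n, 'rV[F]_4),
    forall (M : 'M[F]_n) (i i' : 'I_n) (s : seq 'I_n),
    i' = i.+1 :> nat -> (size s <= 3)%N ->
    (forall r c, r != c -> (r, c) != (i, i') -> M r c = 0) ->
    (forall k, k \notin s -> M k k = 0) ->
    (M i i' != 0 -> (i \in s) && (i' \in s)) ->
    f M = 0 -> M = 0.
Proof.
move=> ht [upC dimC _ minC].
have [U upU dimU] := upper_triangular_vspace F n.
have [|| f fC] := @linear_equations F _ 4 U C.
- by apply/subvP => M /upC/upU.
- by rewrite dimC ht.
exists f => M i i' s ii' s3 supp diag0 off fM0.
have upM : upper_triangular M.
  apply/forallP => r; apply/forallP => c; apply/implyP => cr.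
  rewrite supp //; first by rewrite -val_eqE /=; lia.
  by apply: contraTneq cr => -[-> ->]; lia.
(* A nonzero [M] killed by [f] is a codeword, so its weight is at least 4, yet its shape bounds the
   weight by [size s]. *)
apply: contraTeq s3 => /(minC M (fC M (upU M upM) fM0)) w4.
by have := flag_rank_weight_le ii' supp diag0 off; lia.
Qed.

(* p i is the image of the diagonal unit E_ii, and e that of E_{i,i+1}, in the
   quotient of the upper triangular matrices by the code. *)
Definition code_points (F : fieldType) n (p : 'I_n -> 'rV[F]_4) : Prop :=
  [/\ forall i j a b, i != j -> a *: p i + b *: p j = 0 -> a = 0 /\ b = 0,
      forall i j k a b c, i != j -> i != k -> j != k ->
        a *: p i + b *: p j + c *: p k = 0 -> [/\ a = 0, b = 0 & c = 0]
    & forall i i' : 'I_n, i' = i.+1 :> nat -> exists e, forall k a b c d,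
        k != i -> k != i' -> a *: p i + b *: e + c *: p i' + d *: p k = 0 ->
        [/\ a = 0, b = 0, c = 0 & d = 0]].

Lemma code_points_exist (F : fieldType) (n t : nat) (C : {vspace 'M[F]_n}) :
  (2 <= n)%N -> (t + 4 = (n * n.+1) %/ 2)%N -> flag_rank_code t 4 C ->
  exists p : 'I_n -> 'rV[F]_4, code_points p.
Proof.
move=> n2 ht hC; have [f fP] := code_parity_check ht hC.
exists (fun i => f (delta_mx i i)).
(* For diagonal matrices this pair merely fills the place of the adjacent indices in
   [code_parity_check]. *)
pose i0 := Ordinal (ltnW n2); pose i1 := Ordinal n2.
have diagE (r c x : 'I_n) : r != c -> (r == x) && (c == x) = false.
  by move=> rc; apply: contraNF rc => /andP[/eqP-> /eqP->].
have i01 : i0 != i1 by [].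
split.
- move=> i j a b ij; rewrite -!linearZ -linearD /= => fM0.
  have {fM0} : a *: delta_mx i i + b *: delta_mx j j = 0 :> 'M[F]_n.
    apply: fP fM0; first exact: (erefl : i1 = i0.+1 :> nat).
    + exact: (erefl : size [:: i; j] <= 3)%N.
    + by move=> r c rc _; rewrite !mxE !diagE // !mulr0 addr0.
    + move=> k; rewrite !inE negb_or => /andP[/negPf ki /negPf kj].
      by rewrite !mxE ki kj !mulr0 addr0.
    + by rewrite !mxE !diagE // !mulr0 addr0 eqxx.
  move/matrixP => M0; have := M0 i i; have := M0 j j.
  rewrite !mxE !eqxx eq_sym (negPf ij) !mulr1 !mulr0 addr0 add0r.
  by [].
- move=> i j k a b c ij ik jk; rewrite -!linearZ -!linearD /= => fM0.
  have {fM0} : a *: delta_mx i i + b *: delta_mx j j + c *: delta_mx k k = 0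
      :> 'M[F]_n.
    apply: fP fM0; first exact: (erefl : i1 = i0.+1 :> nat).
    + exact: (erefl : size [:: i; j; k] <= 3)%N.
    + by move=> r l rl _; rewrite !mxE !diagE // !mulr0 !addr0.
    + move=> l; rewrite !inE !negb_or => /and3P[/negPf li /negPf lj /negPf lk].
      by rewrite !mxE li lj lk !mulr0 !addr0.
    + by rewrite !mxE !diagE // !mulr0 !addr0 eqxx.
  move/matrixP => M0; have := M0 i i; have := M0 j j; have := M0 k k.
  rewrite !mxE !eqxx ![k == _]eq_sym [j == i]eq_sym.
  rewrite (negPf ij) (negPf ik) (negPf jk) !mulr1 !mulr0 !addr0 !add0r.
  by [].
- move=> i i' ii'; exists (f (delta_mx i i')) => k a b c d ki ki'.
  have ni : i' == i = false by apply/negbTE; rewrite -val_eqE /= ii'; lia.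
  rewrite -!linearZ -!linearD /= => fM0.
  have {fM0} : a *: delta_mx i i + b *: delta_mx i i' + c *: delta_mx i' i'
      + d *: delta_mx k k = 0 :> 'M[F]_n.
    apply: fP fM0; first exact: ii'.
    + exact: (erefl : size [:: i; i'; k] <= 3)%N.
    + move=> r l rl; rewrite !mxE !diagE // xpair_eqE => /negPf ->.
      by rewrite !mulr0 !addr0.
    + move=> l; rewrite !inE !negb_or => /and3P[/negPf li /negPf lj /negPf lk].
      by rewrite !mxE li lj lk !mulr0 !addr0.
    + by rewrite !inE !eqxx orbT.
  move/matrixP => M0.
  have := M0 i i; have := M0 i i'; have := M0 i' i'; have := M0 k k.
  rewrite !mxE !eqxx ![i == k]eq_sym ![i' == k]eq_sym ![i == i']eq_sym.
  rewrite (negPf ki) (negPf ki') ni !mulr1 !mulr0 !addr0 !add0r.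
  by [].
Qed.

(** * The cap *)

Lemma code_points_cap (F : fieldType) n (p : 'I_n -> 'rV[F]_4) :
  (2 <= n)%N -> code_points p ->
  exists S : {fset pg_point 3 F}, cap S /\ #|` S|%fset = n.
Proof.
move=> n2 [indep2 indep3 _].
have dimp i : \dim <[p i]> == 1%N.
  rewrite dim_vline eqb1.
  (* That [p i] is nonzero is read off from its independence with some other [p j]. *)
  have [j ij] : exists j, i != j.
    have [i0 | i0] := eqVneq i (Ordinal n2).
      by exists (Ordinal (ltnW n2)); rewrite i0.
    by exists (Ordinal n2).
  apply: contraTneq isT => p0.
  have e0 : 1 *: p i + 0 *: p j = 0 by rewrite p0 scaler0 scale0r addr0.
  by have [/eqP] := indep2 _ _ _ _ ij e0; rewrite oner_eq0.
pose P i := PGPoint (dimp i) : pg_point 3 F.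
have Pinj : injective P.
  move=> i j /(congr1 (@pg_space 3 F)) /= lineP; apply/eqP.
  apply: contraT => ij; have := memv_line (p i); rewrite lineP => /vlineP[x px].
  have e0 : 1 *: p i + - x *: p j = 0 by rewrite px scale1r scaleNr subrr.
  by have [/eqP] := indep2 _ _ _ _ ij e0; rewrite oner_eq0.
exists [fset P i | i in 'I_n]%fset; split; last first.
  by rewrite card_imfset //= -cardE card_ord.
move=> _ _ _ /imfsetP[i _ ->] /imfsetP[j _ ->] /imfsetP[k _ ->].
rewrite !(inj_eq Pinj) => ij ik jk [L [dimL /= iL jL kL]].
have free3 : free [:: p i; p j; p k].
  apply/(@freeP _ _ 3 [tuple p i; p j; p k]) => c.
  rewrite !big_ord_recl big_ord0 /= addr0 addrA.
  move=> /(indep3 _ _ _ _ _ _ ij ik jk) [c0 c1 c2] [[|[|[|//]]] lti];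
  [rewrite -[RHS]c0 | rewrite -[RHS]c1 | rewrite -[RHS]c2];
  by congr (c _); apply: val_inj.
have : (\dim <<[:: p i; p j; p k]>> <= \dim L)%N.
  apply: dimvS; apply/span_subvP => v.
  by rewrite !inE => /or3P[] /eqP ->; rewrite memvE.
by rewrite (eqP free3) dimL.
Qed.

(** * Counting points over a finite field *)

Lemma code_points_bound (F : fieldType) n (p : 'I_n -> 'rV[F]_4) q :
  code_points p -> has_card F q -> (n <= 3 + q.-1 * q)%N.
Proof.
move=> [_ indep3 indep4] [elts eltsP <-].
have [n3 | n3] := leqP n 3; first exact: leq_trans n3 (leq_addr _ _).
pose i0 := Ordinal (ltnW (ltnW (ltnW n3))).
pose i1 := Ordinal (ltnW (ltnW n3)); pose i2 := Ordinal (ltnW n3).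
have [e0 indep0] := indep4 i0 i1 erefl.
have [e1 indep1] := indep4 i1 i2 erefl.
(* A further index with coefficient 0 turns the four-term independence into that of the three
   spanning vectors. *)
have [|h0 h0P] := @plane_equation F (p i0) e0 (p i1).
  move=> x y z xyz; have [] // := indep0 i2 x y z 0 isT isT.
  by rewrite scale0r addr0.
have [|h1 h1P] := @plane_equation F (p i1) e1 (p i2).
  move=> x y z xyz; have [] // := indep1 i0 x y z 0 isT isT.
  by rewrite scale0r addr0.
have [|h h2P] := @plane_equation F (p i0) (p i1) (p i2).
  by move=> x y z; apply: indep3.
pose f (w : 'cV[F]_4) (v : 'rV[F]_4) : F := (v *m w) 0 0.
have fD w a b u v : f w (a *: u + b *: v) = a * f w u + b * f w v.
  by rewrite /f mulmxDl -!scalemxAl !mxE.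
have f0_neq0 k : k != i0 -> k != i1 -> f h0 (p k) != 0.
  move=> k0 k1; apply/eqP => /h0P[x [y [z pk]]].
  have [|_ _ _ /eqP] := indep0 k x y z (-1) k0 k1.
    by rewrite -pk scaleN1r subrr.
  by rewrite oppr_eq0 oner_eq0.
have f1_neq0 k : k != i1 -> k != i2 -> f h1 (p k) != 0.
  move=> k1 k2; apply/eqP => /h1P[x [y [z pk]]].
  have [|_ _ _ /eqP] := indep1 k x y z (-1) k1 k2.
    by rewrite -pk scaleN1r subrr.
  by rewrite oppr_eq0 oner_eq0.
have f0_i0 : f h0 (p i0) = 0.
  by apply/h0P; exists 1, 0, 0; rewrite scale1r !scale0r !addr0.
have f0_i1 : f h0 (p i1) = 0.
  by apply/h0P; exists 0, 0, 1; rewrite scale1r !scale0r !add0r.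
have f1_i1 : f h1 (p i1) = 0.
  by apply/h1P; exists 1, 0, 0; rewrite scale1r !scale0r !addr0.
(* f h0, f h1, f h are homogeneous coordinates for the projection from p i1. *)
have common_zero u : f h0 u = 0 -> f h1 u = 0 -> f h u = 0 ->
    exists y, u = y *: p i1.
  move=> u0 u1 /h2P[x [y [z def_u]]]; exists y.
  (* On the plane of [p i0], [p i1], [p i2], the form [h0] detects only the third coefficient; then
     [h1] detects the first. *)
  have z0 : z = 0.
    move: u0; rewrite def_u -[X in X + _]scale1r !fD f0_i0 f0_i1.
    rewrite !mulr0 addr0 mulr0 add0r.
    by move/eqP; rewrite mulf_eq0 (negPf (f0_neq0 i2 isT isT)) orbF => /eqP.
  have x0 : x = 0.
    move: u1; rewrite def_u z0 scale0r addr0 fD f1_i1 mulr0 addr0.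
    by move/eqP; rewrite mulf_eq0 (negPf (f1_neq0 i0 isT isT)) orbF => /eqP.
  by rewrite def_u x0 z0 !scale0r add0r addr0.
(* Affine coordinates of the projection: the line [h0 = 0] is at infinity and the line [h1 = 0] is
   where the first coordinate vanishes. *)
pose phi k := (f h1 (p k) / f h0 (p k), f h (p k) / f h0 (p k)).
pose S := [predC [:: i0; i1; i2]].
pose target := [seq (x, y) | x <- filter (predC1 0) elts, y <- elts].
have mem_elts x : x \in elts by rewrite -has_pred1 has_count eltsP.
have S_neq k : k \in S -> [/\ k != i0, k != i1 & k != i2].
  by rewrite !inE !negb_or => /and3P[].
have phi_inj : {in S &, injective phi}.
  move=> k l /S_neq[k0 k1 k2] /S_neq[l0 l1 l2] [eq1 eq2].
  have fk := f0_neq0 k k0 k1; have fl := f0_neq0 l l0 l1.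
  have cross a b : a / f h0 (p k) = b / f h0 (p l) ->
      f h0 (p l) * a + - f h0 (p k) * b = 0.
    move/eqP; rewrite eqr_div // => /eqP ab.
    by rewrite mulNr [f h0 (p k) * _]mulrC -ab mulrC subrr.
  (* This combination cancels all three homogeneous coordinates, so it is a multiple of [p i1]; for
     [k != l] that contradicts independence of three points. *)
  have [|||y def_u] :=
    common_zero (f h0 (p l) *: p k + - f h0 (p k) *: p l).
  - by rewrite fD mulNr mulrC subrr.
  - by rewrite fD cross.
  - by rewrite fD cross.
  apply/eqP; apply: contraTT fl => kl; rewrite negbK; apply/eqP.
  have [] // := indep3 k l i1 (f h0 (p l)) (- f h0 (p k)) (- y) kl k1 l1.
  by rewrite def_u scaleNr subrr.
have sub_target : {subset [seq phi k | k in S] <= target}.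
  move=> _ /imageP[k /S_neq[k0 k1 k2] ->].
  apply: allpairs_f; rewrite ?mem_filter mem_elts // andbT /=.
  by rewrite mulf_neq0 ?invr_eq0 ?f0_neq0 ?f1_neq0.
have uniqS : uniq [seq phi k | k in S].
  rewrite map_inj_in_uniq ?enum_uniq // => k l.
  by rewrite !mem_enum; apply: phi_inj.
have := uniq_leq_size uniqS sub_target.
have -> : size target = ((size elts).-1 * size elts)%N.
  rewrite size_allpairs size_filter; congr (_ * _)%N.
  by have := count_predC (pred1 0) elts; rewrite eltsP => <-.
have cardS : (#|[:: i0; i1; i2]| + #|S| = n)%N.
  exact: etrans (cardC _) (card_ord n).
have card3 := card_size [:: i0; i1; i2].
by rewrite size_image -[X in _ -> (X <= _)%N]cardS; apply: leq_add.
Qed.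

Theorem theorem4p24 (F : fieldType) (n t : nat) (C : {vspace 'M[F]_n})
    (hn : (2 <= n)%N)
    (ht : (t + 4 = (n * n.+1) %/ 2)%N)
    (hC : flag_rank_code t 4 C) :
  [/\ exists S : {fset pg_point 3 F}, cap S /\ #|` S|%fset = n,
      has_card F 2 -> (n <= 8)%N
    & forall q : nat, has_card F q -> (2 < q)%N -> (n <= q ^ 2 + 1)%N].
Proof.
have [p pP] := code_points_exist hn ht hC; split.
- exact: code_points_cap hn pP.
(* For [q = 2] the bound is 5; in general [3 + (q - 1) q <= q ^ 2 + 1] amounts to [2 <= q]. *)
- by move=> /(code_points_bound pP); lia.
- move=> [//|q] /(code_points_bound pP) /= nq q2; apply: leq_trans nq _.
  by rewrite expnS expn1; nia.
Qed.
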